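(* Let $\omega\in\mathcal{B}'_0$ with $\omega(z)=c_1z+c_2z^2+c_3z^3+\cdots$. Then $$|c_3-c_1c_2|\le\begin{cases}\frac{1}{48}(1+|c_1|)\left[9|c_1|^2-16|c_1|+16\right], & 0\le|c_1|\le\frac47,\\[2mm] \frac56|c_1|(1-|c_1|^2), & \frac47\le|c_1|\le1.\end{cases}$$ The estimate is sharp for $|c_1|=0$ and for $\frac47\le|c_1|\le1$; that is, for every $t\in\{0\}\cup[\frac47,1]$ there is a function in $\mathcal{B}'_0$ with $|c_1|=t$ for which equality holds.
   Context: Let $\mathbb{D}=\{z\in\mathbb{C}:|z|<1\}$. The class $\mathcal{B}'_0$ consists of all functions $\omega$ analytic in $\mathbb{D}$ of the form $\omega(z)=c_1z+c_2z^2+c_3z^3+\cdots$ (with $c_1,c_2,\ldots\in\mathbb{C}$, so $\omega(0)=0$) such that $|\omega'(z)|\le1$ for all $z\in\mathbb{D}$. *)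

(* Defs.v *)
From Stdlib Require Export Reals.
From Stdlib Require Import Lra.
From Coquelicot Require Export Coquelicot.

Local Open Scope C_scope.

(** [ex_derive] is taken over the field of scalars [C], so this is
    complex differentiability at every point of the open unit disc.
    Functions are total on [C]; their values off the disc are irrelevant. *)
Definition analytic_in_disc (w : C -> C) : Prop :=
  forall z : C, (Cmod z < 1)%R -> ex_derive w z.

Definition power_expansion (w : C -> C) (c : nat -> C) : Prop :=
  c 0%nat = 0 /\ (forall z : C, (Cmod z < 1)%R -> is_pseries c z (w z)).

Definition class_B0' (w : C -> C) : Prop :=
  analytic_in_disc w /\
  (exists c : nat -> C, power_expansion w c) /\
  (forall z : C, (Cmod z < 1)%R -> (Cmod (C_derive w z) <= 1)%R).

Local Open Scope R_scope.

(** Meant for [0 <= t <= 1]; the two branches agree at [t = 4 / 7], see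
    [coef_bound_right]. *)
Definition coef_bound (t : R) : R :=
  if Rle_dec t (4 / 7)
  then 1 / 48 * (1 + t) * (9 * t ^ 2 - 16 * t + 16)
  else 5 / 6 * t * (1 - t ^ 2).

Lemma coef_bound_right (t : R) :
  4 / 7 <= t -> coef_bound t = 5 / 6 * t * (1 - t ^ 2).
Proof.
intros ht; unfold coef_bound; destruct (Rle_dec t (4 / 7)) as [h|h].
- replace t with (4 / 7) by lra; field.
- reflexivity.
Qed.

(* Main.v *)
Require Import Defs.
From Stdlib Require Import Reals Arith Lra Lia.
From Coquelicot Require Import Coquelicot.

(** The derivative [f = w'] is an analytic function bounded by 1 whose
    coefficients are [a_n = (n + 1) c_(n+1)], and
    [c3 - c1 c2 = a2 / 3 - a0 a1 / 2]. The first three coefficients of such a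
    function are given by Schur parameters: with [D = 1 - |a0|^2],
    [a1 = D b0] and [a2 = D (b1 - conj a0 b0^2)] where [|b0| <= 1] and
    [|b1| <= 1 - |b0|^2]. Substituting and taking absolute values bounds the
    functional by [(1 - t^2) ((1 - x^2) / 3 + t x^2 / 3 + t x / 2)] with
    [t = |c1|] and [x = |b0|]; its maximum over [0 <= x <= 1] is the stated
    bound, the two cases corresponding to the vertex of this quadratic lying
    inside or outside the interval ([real_optimum]).

    The Schur parameters are obtained without the maximum principle. For a
    polynomial bounded by [M] on the unit circle, averaging over roots of unity
    shows that its lower triangular 3 by 3 Toeplitz matrix has operator norm at
    most [M] ([toeplitz_le_of_polynomial]). Approximating [f] on circles of
    radius [r < 1] by partial sums, and letting [r] tend to 1, makes the Toeplitz
    matrix of [f] a contraction ([toeplitz_contraction]). Testing this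
    contraction on well-chosen vectors yields the inequalities for [b0] and [b1]
    ([schur_parametrisation]).

    The link between [w'] and the coefficients of [w], in both directions, is
    termwise differentiation of complex power series
    ([pseries_termwise_derive]). For sharpness it produces members of the class
    with prescribed derivative ([primitive_in_class]): [w' = z^2] for [t = 0] and
    [w' = (t + z) / (1 + t z)] for [t >= 4/7], a disc automorphism if [t < 1] and
    the constant 1 if [t = 1]. *)

Notation Csum := (sum_n (G := C_AbelianMonoid)).

(** * Complex power series *)

Local Open Scope R_scope.

Lemma is_series_C_eps (a : nat -> C) (l : C) :
  is_series (V := C_NormedModule) a l <->
  forall eps : posreal,
    exists N, forall n, (N <= n)%nat -> Cmod (Csum a n - l)%C < eps.
Proof.
exact (filterlim_locally_ball_norm (U := C_NormedModule) (sum_n a) l).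
Qed.

Lemma sum_n_C_tail_le (a : nat -> C) (b : nat -> R) (N m : nat) :
  (forall n, Cmod (a n) <= b n) -> (N <= m)%nat ->
  Cmod (Csum a m - Csum a N)%C <= sum_n b m - sum_n b N.
Proof.
intros Hab HNm.
replace (sum_n b m - sum_n b N) with (sum_n_m b (S N) m)
  by exact (sum_n_m_sum_n (G := R_AbelianGroup) b N m HNm).
replace (Csum a m - Csum a N)%C
  with (sum_n_m (G := C_AbelianMonoid) a (S N) m)
  by exact (sum_n_m_sum_n (G := C_AbelianGroup) a N m HNm).
eapply Rle_trans.
- exact (norm_sum_n_m (V := C_NormedModule) a (S N) m).
- apply sum_n_m_le; exact Hab.
Qed.

(** The bound on the tail depends on [a] only through the majorant [b]; this
    is what makes partial sums converge uniformly on a circle. *)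
Lemma is_series_C_tail_le (a : nat -> C) (b : nat -> R) (l : C) (B : R) (N : nat) :
  is_series (V := C_NormedModule) a l -> is_series b B ->
  (forall n, Cmod (a n) <= b n) ->
  Cmod (l - Csum a N)%C <= B - sum_n b N.
Proof.
intros Ha Hb Hab.
apply le_epsilon; intros eps Heps.
assert (He : 0 < eps / 2) by lra.
destruct (proj1 (is_series_C_eps a l) Ha (mkposreal _ He)) as [N1 H1].
assert (Hb' := proj1 (filterlim_locally_ball_norm (U := R_NormedModule) (sum_n b) B) Hb (mkposreal _ He)).
destruct Hb' as [N2 H2].
set (m := (N + N1 + N2)%nat).
specialize (H1 m ltac:(unfold m; lia)).
specialize (H2 m ltac:(unfold m; lia)).
assert (H2' : Rabs (sum_n b m - B) < eps / 2) by exact H2.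
apply Rabs_def2 in H2'. simpl in H1.
assert (H3 := sum_n_C_tail_le a b N m Hab ltac:(unfold m; lia)).
replace (l - Csum a N)%C with
 (- (Csum a m - l) + (Csum a m - Csum a N))%C by ring.
eapply Rle_trans; [apply Cmod_triangle|].
rewrite Cmod_opp; lra.
Qed.

Lemma is_series_C_norm_le (a : nat -> C) (b : nat -> R) (l : C) (B : R) :
  is_series (V := C_NormedModule) a l -> is_series b B ->
  (forall n, Cmod (a n) <= b n) -> Cmod l <= B.
Proof.
intros Ha Hb Hab.
assert (H := is_series_C_tail_le a b l B 0 Ha Hb Hab).
rewrite !sum_O in H.
replace l with ((l - a 0%nat) + a 0%nat)%C by ring.
eapply Rle_trans; [apply Cmod_triangle|].
specialize (Hab 0%nat); lra.
Qed.

Lemma is_pseries_C (a : nat -> C) (z l : C) :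
  is_pseries (V := C_NormedModule) a z l <->
  is_series (V := C_NormedModule) (fun n => (a n * z ^ n)%C) l.
Proof.
unfold is_pseries; split; apply is_series_ext; intros n;
  apply Cmult_comm.
Qed.

Definition converges_in_disc (a : nat -> C) : Prop :=
  forall z : C, Cmod z < 1 -> ex_pseries (V := C_NormedModule) a z.

(** The terms of a convergent series are bounded: the increment of the partial
    sums is eventually at most 2, and finitely many terms remain. *)
Lemma coef_bounded_of_pseries (a : nat -> C) (z l : C) :
  is_pseries (V := C_NormedModule) a z l ->
  exists M, forall n, Cmod (a n) * Cmod z ^ n <= M.
Proof.
intros H%is_pseries_C.
destruct (proj1 (is_series_C_eps _ l) H (mkposreal 1 Rlt_0_1)) as [N HN]; simpl in HN.
assert (Hf : exists M, forall n, (n <= N)%nat -> Cmod (a n) * Cmod z ^ n <= M).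
{ clear HN; induction N as [|N [M IH]].
  - exists (Cmod (a 0%nat) * Cmod z ^ 0); intros n Hn.
    replace n with 0%nat by lia; lra.
  - exists (Rmax M (Cmod (a (S N)) * Cmod z ^ S N)); intros n Hn.
    destruct (Nat.eq_dec n (S N)) as [->|Hne]; [apply Rmax_r|].
    eapply Rle_trans; [apply IH; lia|apply Rmax_l]. }
destruct Hf as [M HM].
exists (Rmax M 2); intros n.
destruct (Nat.le_gt_cases n N) as [Hn|Hn].
- eapply Rle_trans; [apply HM, Hn|apply Rmax_l].
- eapply Rle_trans; [|apply Rmax_r].
  destruct n as [|n]; [lia|].
  rewrite <- Cmod_pow, <- Cmod_mult.
  assert (H1 := HN n ltac:(lia)); assert (H2 := HN (S n) ltac:(lia)).
  rewrite sum_Sn in H2.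
  set (s := sum_n _ n) in *.
  set (t := (a (S n) * z ^ S n)%C) in *.
  replace t with ((s + t - l) + - (s - l))%C by ring.
  eapply Rle_trans; [apply Cmod_triangle|].
  rewrite Cmod_opp.
  change (plus s t) with (s + t)%C in H2; lra.
Qed.

(** Passing to the moduli of the coefficients brings in the theory of the
    radius of convergence of real power series: absolute convergence, and
    stability of the radius under formal differentiation. The strict inequality
    comes from evaluating at a real point between [r] and 1. *)
Lemma radius_ge_1 (a : nat -> C) (r : R) :
  converges_in_disc a -> 0 <= r < 1 ->
  Rbar_lt (Rabs r) (CV_radius (fun n => Cmod (a n))).
Proof.
intros Ha Hr.
rewrite Rabs_pos_eq by lra.
set (s := (r + 1) / 2).
assert (Hs : 0 < s < 1) by (unfold s; lra).
assert (Hcs : Cmod s = s) by (rewrite Cmod_R; apply Rabs_pos_eq; lra).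
destruct (Ha s) as [l Hl]; [lra|].
destruct (coef_bounded_of_pseries a s l Hl) as [M HM].
apply Rbar_lt_le_trans with s; [unfold s; simpl; lra|].
apply (proj1 (CV_radius_bounded _)).
exists M; intros n.
rewrite Hcs in HM.
rewrite Rabs_pos_eq; [apply HM|].
apply Rmult_le_pos; [apply Cmod_ge_0|apply pow_le; lra].
Qed.

Lemma ex_series_Cmod (a : nat -> C) (r : R) :
  converges_in_disc a -> 0 <= r < 1 -> ex_series (fun n => Cmod (a n) * r ^ n).
Proof.
intros Ha Hr.
apply ex_series_Rabs, CV_disk_inside, radius_ge_1; assumption.
Qed.

(** Second-order Taylor remainder of a monomial on a disc of radius [rho],
    from the recursion
    [R_(n+1) = y R_n + n z^(n-1) (y - z)^2]. The index is shifted by two since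
    the remainder vanishes in degrees 0 and 1. *)
Lemma power_remainder (y z : C) (rho : R) (n : nat) :
  Cmod y <= rho -> Cmod z <= rho ->
  Cmod (y ^ S (S n) - z ^ S (S n) - INR (S (S n)) * z ^ S n * (y - z))%C
  <= INR (S (S n)) * INR (S n) * rho ^ n * Cmod (y - z)%C ^ 2.
Proof.
intros Hy Hz.
assert (Hrho : 0 <= rho) by (eapply Rle_trans; [apply Cmod_ge_0|exact Hy]).
induction n as [|n IH].
- replace (y ^ 2 - z ^ 2 - INR 2 * z ^ 1 * (y - z))%C with ((y - z) ^ 2)%C.
  + rewrite Cmod_pow. simpl. assert (H := pow2_ge_0 (Cmod (y - z)%C)); simpl in H. lra.
  + change (INR 2) with (1+1); rewrite RtoC_plus; ring.
- replace (y ^ S (S (S n)) - z ^ S (S (S n)) - INR (S (S (S n))) * z ^ S (S n) * (y - z))%C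
    with (y * (y ^ S (S n) - z ^ S (S n) - INR (S (S n)) * z ^ S n * (y - z))
          + INR (S (S n)) * z ^ S n * (y - z) ^ 2)%C
    by (rewrite (S_INR (S (S n))), RtoC_plus, !Cpow_S; ring).
  eapply Rle_trans; [apply Cmod_triangle|].
  rewrite !Cmod_mult, !Cmod_pow, Cmod_R, (Rabs_pos_eq (INR _)) by apply pos_INR.
  set (d := Cmod (y - z)%C ^ 2) in *.
  assert (Hd : 0 <= d) by apply pow2_ge_0.
  assert (Hn := pos_INR n).
  assert (Hp : 0 <= rho ^ n) by (apply pow_le; exact Hrho).
  assert (Hzp : Cmod z ^ S n <= rho ^ S n) by (apply pow_incr; split; [apply Cmod_ge_0|exact Hz]).
  apply Rle_trans with
    (rho * (INR (S (S n)) * INR (S n) * rho ^ n * d) + INR (S (S n)) * rho ^ S n * d).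
  + apply Rplus_le_compat.
    * apply Rmult_le_compat; try apply Cmod_ge_0; assumption.
    * apply Rmult_le_compat_r; [exact Hd|].
      apply Rmult_le_compat_l; [apply pos_INR|exact Hzp].
  + rewrite !S_INR; simpl.
    assert (0 <= rho * rho ^ n * d) by (apply Rmult_le_pos; [apply Rmult_le_pos|]; assumption).
    nra.
Qed.

Definition Cderiv_coef (c : nat -> C) (n : nat) : C := (INR (S n) * c (S n))%C.

(** A quadratic bound on the first-order remainder is stronger than the little-o
    condition in the definition of the derivative. *)
Lemma is_derive_C_quadratic (w : C -> C) (z d : C) (K : R) (delta : posreal) :
  (forall y, Cmod (y - z)%C < delta ->
     Cmod (w y - w z - d * (y - z))%C <= K * Cmod (y - z)%C ^ 2) ->
  is_derive (K := C_AbsRing) (V := C_NormedModule) w z d.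
Proof.
intros H; split.
- apply (is_linear_scal_l (K := C_AbsRing) (V := C_NormedModule)).
- intros x Hx.
  apply (is_filter_lim_locally_unique (V := AbsRing_NormedModule C_AbsRing)) in Hx; subst x.
  intros eps.
  set (K' := Rabs K + 1).
  assert (HK : 0 < K') by (unfold K'; assert (h := Rabs_pos K); lra).
  assert (HK' : K <= K') by (unfold K'; assert (h := Rle_abs K); lra).
  assert (He : 0 < Rmin delta (eps / K')).
  { apply Rmin_glb_lt; [apply cond_pos|]. apply Rdiv_lt_0_compat; [apply cond_pos|exact HK]. }
  apply (locally_le_locally_norm (V := AbsRing_NormedModule C_AbsRing)).
  exists (mkposreal _ He); intros y Hy.
  change (Cmod (y - z)%C < Rmin delta (eps / K')) in Hy.
  change (Cmod (w y - w z - (y - z) * d)%C <= eps * Cmod (y - z)%C).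
  assert (Hy1 := Rlt_le_trans _ _ _ Hy (Rmin_l _ _)).
  assert (Hy2 := Rlt_le_trans _ _ _ Hy (Rmin_r _ _)).
  replace ((y - z) * d)%C with (d * (y - z))%C by ring.
  eapply Rle_trans; [apply H, Hy1|].
  assert (Hm := Cmod_ge_0 (y - z)%C).
  set (m := Cmod (y - z)%C) in *.
  assert (K' * m <= eps).
  { apply Rmult_lt_compat_l with (r := K') in Hy2; [|exact HK].
    replace (K' * (eps / K')) with (pos eps) in Hy2 by (field; lra); lra. }
  nra.
Qed.

(** Summing [power_remainder] against the coefficients bounds the first-order
    remainder of [w] at [z] by [|y - z|^2] times the second formal derivative of
    the series of moduli at [rho], the midpoint of [|z|] and 1. *)
Lemma pseries_termwise_derive (c : nat -> C) (w : C -> C) (z : C) :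
  (forall z, Cmod z < 1 -> is_pseries (V := C_NormedModule) c z (w z)) ->
  Cmod z < 1 ->
  exists d : C, is_pseries (V := C_NormedModule) (Cderiv_coef c) z d /\
    is_derive (K := C_AbsRing) (V := C_NormedModule) w z d.
Proof.
intros Hw Hz.
assert (Hz0 := Cmod_ge_0 z).
set (rho := (1 + Cmod z) / 2).
assert (Hrho : 0 <= rho < 1) by (unfold rho; lra).
assert (Hc : converges_in_disc c) by (intros y Hy; exists (w y); apply Hw, Hy).
assert (Hd : ex_series (fun n => (Cderiv_coef c n * z ^ n)%C : C_NormedModule)).
{ apply (ex_series_le (V := C_CompleteNormedModule)) with
    (fun n => Rabs (PS_derive (fun n => Cmod (c n)) n * Cmod z ^ n)).
  - intros n; change (Cmod (Cderiv_coef c n * z ^ n)%C <= Rabs (PS_derive (fun n => Cmod (c n)) n * Cmod z ^ n)).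
    unfold Cderiv_coef, PS_derive.
    rewrite Rabs_pos_eq.
    + rewrite !Cmod_mult, Cmod_pow, Cmod_R, (Rabs_pos_eq (INR _)) by apply pos_INR; lra.
    + repeat apply Rmult_le_pos; try apply pow_le; try apply pos_INR; apply Cmod_ge_0.
  - apply CV_disk_inside; rewrite CV_radius_derive; apply radius_ge_1; [exact Hc|lra]. }
destruct Hd as [d Hd].
exists d; split; [apply is_pseries_C, Hd|].
set (b := fun n => INR (S (S n)) * INR (S n) * Cmod (c (S (S n))) * rho ^ n).
assert (Hb : ex_series b).
{ apply ex_series_ext with (fun n => PS_derive (PS_derive (fun n => Cmod (c n))) n * rho ^ n).
  - intros n; unfold PS_derive, b.
    match goal with |- ?x = ?y => change (@eq R x y) end; ring.
  - apply ex_series_Rabs, CV_disk_inside; rewrite !CV_radius_derive.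
    apply radius_ge_1; [exact Hc|lra]. }
assert (Hdel : 0 < rho - Cmod z) by (unfold rho; lra).
apply is_derive_C_quadratic with (Series b) (mkposreal _ Hdel); simpl.
intros y Hy.
assert (Hyr : Cmod y <= rho).
{ replace y with ((y - z) + z)%C by ring.
  eapply Rle_trans; [apply Cmod_triangle|lra]. }
assert (Hzr : Cmod z <= rho) by (unfold rho; lra).
set (e := fun n => (c n * (y ^ n - z ^ n)
  - match n return C with O => 0 | S m => INR n * c n * z ^ m * (y - z) end)%C).
(* [e] is the series of the remainders of the monomials. *)
assert (He : is_series (V := C_NormedModule) e (w y - w z - d * (y - z))%C).
{ assert (Hy' := proj1 (is_pseries_C _ _ _) (Hw y ltac:(lra))).
  assert (Hz' := proj1 (is_pseries_C _ _ _) (Hw z Hz)).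
  set (g := fun n => match n return C with O => 0 | S m => (INR n * c n * z ^ m * (y - z)) end%C).
  assert (Hg : is_series (V := C_NormedModule) g (d * (y - z))%C).
  { apply (is_series_decr_1 (V := C_NormedModule)).
    match goal with |- is_series _ ?L => replace L with ((y - z) * d)%C end;
      [|change (@eq C ((y - z) * d) (d * (y - z) + - 0))%C; ring].
    eapply is_series_ext;
      [|exact (is_series_scal (V := C_NormedModule) ((y - z) : C_AbsRing)%C _ _ Hd)].
    intros n; unfold g, Cderiv_coef.
    change (@eq C ((y - z) * (INR (S n) * c (S n) * z ^ n))
      (INR (S n) * c (S n) * z ^ n * (y - z)))%C; ring. }
  assert (H := is_series_minus _ _ _ _ (is_series_minus _ _ _ _ Hy' Hz') Hg).
  eapply is_series_ext; [|exact H].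
  intros n; unfold e, g; destruct n as [|n].
  - change (@eq C ((c 0%nat * y ^ 0 + - (c 0%nat * z ^ 0)) + - 0)
      (c 0%nat * (y ^ 0 - z ^ 0) - 0))%C; ring.
  - change (@eq C (c (S n) * y ^ S n + - (c (S n) * z ^ S n) + - (INR (S n) * c (S n) * z ^ n * (y - z)))
      (c (S n) * (y ^ S n - z ^ S n) - INR (S n) * c (S n) * z ^ n * (y - z)))%C; ring. }
(* Its first two terms vanish, which matches the shift in [power_remainder]. *)
assert (He' : is_series (V := C_NormedModule) (fun n => e (S (S n))) (w y - w z - d * (y - z))%C).
{ apply (is_series_incr_1 (V := C_NormedModule) (fun n => e (S n))).
  apply (is_series_incr_1 (V := C_NormedModule) e).
  replace (plus _ _) with (w y - w z - d * (y - z))%C; [exact He|].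
  match goal with |- _ = plus (plus ?A ?B) ?D => change (@eq C A ((A + B) + D))%C end.
  unfold e; simpl; ring. }
refine (is_series_C_norm_le _ _ _ _ He'
  (is_series_scal_r (Cmod (y - z)%C ^ 2) _ _ (Series_correct b Hb)) _).
intros n; unfold e, b.
replace (c (S (S n)) * (y ^ S (S n) - z ^ S (S n))
    - INR (S (S n)) * c (S (S n)) * z ^ S n * (y - z))%C
  with (c (S (S n)) * (y ^ S (S n) - z ^ S (S n) - INR (S (S n)) * z ^ S n * (y - z)))%C by ring.
rewrite Cmod_mult.
assert (H := power_remainder y z rho n Hyr Hzr).
apply Rmult_le_compat_l with (r := Cmod (c (S (S n)))) in H; [|apply Cmod_ge_0].
eapply Rle_trans; [exact H|apply Req_le; ring].
Qed.

(** * Averages over roots of unity *)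

Local Open Scope C_scope.

Definition cis (theta : R) : C := (cos theta, sin theta).

Lemma cis_pow (theta : R) (n : nat) : cis theta ^ n = cis (INR n * theta).
Proof.
induction n as [|n IH].
- unfold cis; rewrite Rmult_0_l, cos_0, sin_0; reflexivity.
- rewrite Cpow_S, IH, S_INR.
  replace ((INR n + 1) * theta)%R with (theta + INR n * theta)%R by ring.
  unfold cis; rewrite cos_plus, sin_plus.
  apply injective_projections; simpl; ring.
Qed.

Lemma Cmod_cis (theta : R) : Cmod (cis theta) = 1%R.
Proof.
unfold Cmod, cis; simpl.
rewrite !Rmult_1_r, Rplus_comm.
change (sqrt (Rsqr (sin theta) + Rsqr (cos theta)) = 1)%R.
rewrite sin2_cos2; apply sqrt_1.
Qed.

(** [N + 1] points, because [sum_n _ N] has [N + 1] terms. *)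
Definition unity_root (N : nat) : C := cis (2 * PI / INR (S N)).

Lemma unity_root_pow_order (N : nat) : unity_root N ^ S N = 1.
Proof.
unfold unity_root; rewrite cis_pow.
replace (INR (S N) * (2 * PI / INR (S N)))%R with (2 * PI)%R
  by (field; apply not_0_INR; lia).
unfold cis; rewrite cos_2PI, sin_2PI; reflexivity.
Qed.

(** Otherwise [sin (m PI / (N + 1))] would vanish, by
    [cos 2x = 1 - 2 sin^2 x]; but this angle lies strictly between 0 and [PI]. *)
Lemma unity_root_primitive (N m : nat) :
  (1 <= m <= N)%nat -> unity_root N ^ m <> 1.
Proof.
intros Hm H.
unfold unity_root in H; rewrite cis_pow in H.
apply (f_equal fst) in H.
change (cos (INR m * (2 * PI / INR (S N))) = 1)%R in H.
set (x := (INR m * PI / INR (S N))%R).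
assert (HN : (0 < INR (S N))%R) by (apply lt_0_INR; lia).
replace (INR m * (2 * PI / INR (S N)))%R with (2 * x)%R in H
  by (unfold x; field; lra).
rewrite cos_2a_sin in H.
assert (Hx : (0 < sin x)%R).
{ assert (Hpi := PI_RGT_0).
  assert (0 < INR m)%R by (apply lt_0_INR; lia).
  assert (INR m < INR (S N))%R by (apply lt_INR; lia).
  apply sin_gt_0.
  - unfold x; apply Rdiv_lt_0_compat; [apply Rmult_lt_0_compat|]; assumption.
  - unfold x; apply Rmult_lt_reg_r with (INR (S N)); [assumption|].
    replace (INR m * PI / INR (S N) * INR (S N))%R with (INR m * PI)%R by (field; lra).
    nra. }
nra.
Qed.

(** Average over the [N + 1]-st roots of unity. On trigonometric polynomials of
    degree at most [N] it coincides with the integral mean over the unit circle,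
    so it gives the Fourier coefficients without any integration. *)
Definition circle_mean (N : nat) (phi : C -> C) : C :=
  / INR (S N) * Csum (fun k => phi (unity_root N ^ k)) N.

Lemma INR_S_neq_0 (N : nat) : RtoC (INR (S N)) <> 0.
Proof. intros H%RtoC_inj; revert H; apply not_0_INR; lia. Qed.

Lemma circle_mean_ext (N : nat) (phi psi : C -> C) :
  (forall zeta, Cmod zeta = 1%R -> phi zeta = psi zeta) ->
  circle_mean N phi = circle_mean N psi.
Proof.
intros H; unfold circle_mean; f_equal.
apply sum_n_ext; intros k; apply H.
unfold unity_root; rewrite cis_pow; apply Cmod_cis.
Qed.

Lemma circle_mean_plus (N : nat) (phi psi : C -> C) :
  circle_mean N (fun zeta => phi zeta + psi zeta) = circle_mean N phi + circle_mean N psi.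
Proof.
unfold circle_mean; rewrite <- Cmult_plus_distr_l; f_equal.
exact (sum_n_plus (G := C_AbelianMonoid) _ _ N).
Qed.

Lemma circle_mean_scal (N : nat) (a : C) (phi : C -> C) :
  circle_mean N (fun zeta => a * phi zeta) = a * circle_mean N phi.
Proof.
unfold circle_mean.
replace (Csum (fun k => a * phi (unity_root N ^ k)) N)
  with (a * Csum (fun k => phi (unity_root N ^ k)) N)
  by (symmetry; exact (sum_n_mult_l (K := C_Ring) a _ N)).
ring.
Qed.

Lemma Csum_conj (u : nat -> C) (N : nat) :
  Csum (fun k => Cconj (u k)) N = Cconj (Csum u N).
Proof.
induction N as [|N IH]; [rewrite !sum_O; reflexivity|].
rewrite !sum_Sn, IH; symmetry; exact (Cplus_conj _ _).
Qed.

Lemma circle_mean_conj (N : nat) (phi : C -> C) :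
  circle_mean N (fun zeta => Cconj (phi zeta)) = Cconj (circle_mean N phi).
Proof.
unfold circle_mean; rewrite Csum_conj, Cmult_conj, Cinv_conj by apply INR_S_neq_0.
f_equal; f_equal; apply injective_projections; simpl; ring.
Qed.

Lemma circle_mean_Re_le (N : nat) (phi psi : C -> C) :
  (forall zeta, Cmod zeta = 1%R -> (Re (phi zeta) <= Re (psi zeta))%R) ->
  (Re (circle_mean N phi) <= Re (circle_mean N psi))%R.
Proof.
intros H.
assert (HN : (0 < INR (S N))%R) by (apply lt_0_INR; lia).
assert (Hre : forall z : C, Re (/ INR (S N) * z) = (/ INR (S N) * Re z)%R)
  by (intros z; rewrite <- RtoC_inv by lra; unfold Re, Cmult, RtoC; cbn [fst snd]; ring).
unfold circle_mean; rewrite !Hre.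
apply Rmult_le_compat_l; [left; apply Rinv_0_lt_compat, HN|].
assert (Hk : forall k, (Re (phi (unity_root N ^ k)%C) <= Re (psi (unity_root N ^ k)%C))%R)
  by (intros k; apply H; unfold unity_root; rewrite cis_pow; apply Cmod_cis).
generalize N at 2 4; intros n; clear -Hk.
induction n as [|n IH]; [rewrite !sum_O; apply Hk|].
rewrite !sum_Sn; exact (Rplus_le_compat _ _ _ _ IH (Hk (S n))).
Qed.

Lemma Csum_geom (q : C) (N : nat) :
  (q - 1) * Csum (fun k => q ^ k) N = q ^ S N - 1.
Proof.
induction N as [|N IH]; [rewrite sum_O; simpl; ring|].
rewrite sum_Sn.
change ((q - 1) * (Csum (fun k => q ^ k) N + q ^ S N) = q ^ S (S N) - 1).
rewrite Cmult_plus_distr_l, IH, (Cpow_S q (S N)); ring.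
Qed.

Lemma circle_mean_1 (N : nat) : circle_mean N (fun _ => 1) = 1.
Proof.
unfold circle_mean.
replace (Csum (fun _ => RtoC 1) N) with (RtoC (INR (S N))).
- apply Cinv_l, INR_S_neq_0.
- induction N as [|N IH]; [rewrite sum_O; reflexivity|].
  rewrite sum_Sn, <- IH, S_INR, RtoC_plus; reflexivity.
Qed.

Lemma circle_mean_pow (N m : nat) :
  (1 <= m <= N)%nat -> circle_mean N (fun zeta => zeta ^ m) = 0.
Proof.
intros Hm; unfold circle_mean.
rewrite (sum_n_ext (G := C_AbelianMonoid) _ (fun k => (unity_root N ^ m) ^ k))
  by (intros k; rewrite <- !Cpow_mult_r; f_equal; lia).
set (q := unity_root N ^ m).
assert (Hq : q - 1 <> 0).
{ intros E; apply (unity_root_primitive N m Hm).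
  replace (unity_root N ^ m) with (q - 1 + 1) by (unfold q; ring).
  rewrite E; ring. }
assert (H := Csum_geom q N).
replace (q ^ S N) with (RtoC 1) in H.
- set (s := Csum _ N) in *.
  replace s with (/ (q - 1) * ((q - 1) * s)) by (field; exact Hq).
  rewrite H; ring.
- unfold q; rewrite <- Cpow_mult_r, Nat.mul_comm, Cpow_mult_r, unity_root_pow_order, Cpow_1_l; reflexivity.
Qed.

Lemma conj_mul_unit (zeta : C) : Cmod zeta = 1%R -> Cconj zeta * zeta = 1.
Proof. intros H; rewrite Cmult_comm, <- Cmod2_conj, H; f_equal; ring. Qed.

(** Orthonormality of the monomials: on the unit circle [Cconj zeta] is the
    inverse of [zeta], so the product is a single power of [zeta] or of its
    conjugate. *)
Lemma circle_mean_monomial (N a b : nat) :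
  (a <= N)%nat -> (b <= N)%nat ->
  circle_mean N (fun zeta => Cconj zeta ^ a * zeta ^ b) = if Nat.eq_dec a b then 1 else 0.
Proof.
intros Ha Hb.
destruct (Nat.eq_dec a b) as [<-|Hab].
- rewrite <- (circle_mean_1 N); apply circle_mean_ext; intros zeta Hz.
  rewrite <- Cpow_mult_l, conj_mul_unit, Cpow_1_l by exact Hz; reflexivity.
- destruct (Nat.lt_ge_cases a b) as [Hlt|Hge].
  + rewrite <- (circle_mean_pow N (b - a)) by lia.
    apply circle_mean_ext; intros zeta Hz.
    replace (zeta ^ b) with (zeta ^ a * zeta ^ (b - a)) by (rewrite <- Cpow_add_r; f_equal; lia).
    rewrite Cmult_assoc, <- Cpow_mult_l, conj_mul_unit, Cpow_1_l by exact Hz; ring.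
  + replace (RtoC 0) with (Cconj (circle_mean N (fun zeta => zeta ^ (a - b))))
      by (rewrite circle_mean_pow by lia; apply injective_projections; simpl; ring).
    rewrite <- circle_mean_conj; apply circle_mean_ext; intros zeta Hz.
    rewrite Cpow_conj.
    replace (Cconj zeta ^ a) with (Cconj zeta ^ (a - b) * Cconj zeta ^ b)
      by (rewrite <- Cpow_add_r; f_equal; lia).
    rewrite <- Cmult_assoc, <- Cpow_mult_l, conj_mul_unit, Cpow_1_l by exact Hz; ring.
Qed.

(** The mean extracts the coefficient of [zeta ^ m]. The right-hand side is left
    as a sum so that the induction on the degree goes through; [Csum_delta]
    evaluates it. *)
Lemma circle_mean_polynomial (N m i d : nat) (A : nat -> C) :
  (m <= N)%nat -> (d + i <= N)%nat ->
  circle_mean N (fun zeta => Cconj zeta ^ m * (zeta ^ i * Csum (fun n => A n * zeta ^ n) d))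
  = Csum (fun n => A n * (if Nat.eq_dec m (n + i) then 1 else 0)) d.
Proof.
intros Hm Hd.
induction d as [|d IH].
- rewrite sum_O, <- circle_mean_monomial with (N := N) by lia.
  rewrite <- circle_mean_scal; apply circle_mean_ext; intros zeta _.
  rewrite sum_O; simpl; ring.
- rewrite sum_Sn, <- IH, <- circle_mean_monomial with (N := N) by lia.
  change (@plus C_AbelianMonoid) with Cplus.
  rewrite <- circle_mean_scal, <- circle_mean_plus; apply circle_mean_ext; intros zeta _.
  rewrite sum_Sn, Cpow_add_r; change (@plus C_AbelianMonoid) with Cplus; ring.
Qed.

Lemma Csum_delta (A : nat -> C) (m i d : nat) :
  @eq C (Csum (fun n => A n * (if Nat.eq_dec m (n + i) then 1 else 0)) d)
    (if le_dec i m then if le_dec m (d + i) then A (m - i)%nat else 0 else 0).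
Proof.
induction d as [|d IH].
- rewrite sum_O; destruct (Nat.eq_dec m (0 + i)), (le_dec i m), (le_dec m (0 + i)); try lia; try ring.
  replace (m - i)%nat with 0%nat by lia; ring.
- rewrite sum_Sn, IH; change (@plus C_AbelianMonoid) with Cplus.
  destruct (Nat.eq_dec m (S d + i)), (le_dec i m), (le_dec m (d + i)), (le_dec m (S d + i)); try lia; try ring.
  replace (m - i)%nat with (S d) by lia; ring.
Qed.

Definition quad (p0 p1 p2 zeta : C) : C := p0 + p1 * zeta + p2 * zeta ^ 2.

Definition sq3 (p0 p1 p2 : C) : R := (Cmod p0 ^ 2 + Cmod p1 ^ 2 + Cmod p2 ^ 2)%R.

(** Squared norm of the image of the vector [(p0, p1, p2)] under the lower
    triangular Toeplitz matrix of [a]: the first three coefficients of the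
    product of [p0 + p1 z + p2 z^2] with the series of [a]. *)
Definition toeplitz_sq (a : nat -> C) (p0 p1 p2 : C) : R :=
  sq3 (p0 * a 0%nat) (p0 * a 1%nat + p1 * a 0%nat)
    (p0 * a 2%nat + p1 * a 1%nat + p2 * a 0%nat).

Lemma circle_mean_conj_quad_mul (N : nat) (q0 q1 q2 : C) (F : C -> C) :
  circle_mean N (fun zeta => Cconj (quad q0 q1 q2 zeta) * F zeta) =
  Cconj q0 * circle_mean N (fun zeta => Cconj zeta ^ 0 * F zeta) +
  Cconj q1 * circle_mean N (fun zeta => Cconj zeta ^ 1 * F zeta) +
  Cconj q2 * circle_mean N (fun zeta => Cconj zeta ^ 2 * F zeta).
Proof.
rewrite <- !circle_mean_scal, <- !circle_mean_plus.
apply circle_mean_ext; intros zeta _; unfold quad.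
rewrite !Cplus_conj, !Cmult_conj, Cpow_conj; ring.
Qed.

Lemma circle_mean_coef_quad_mul (N d m : nat) (p0 p1 p2 : C) (A : nat -> C) :
  (m <= 2)%nat -> (2 <= d)%nat -> (d + 2 <= N)%nat ->
  circle_mean N (fun zeta =>
    Cconj zeta ^ m * (quad p0 p1 p2 zeta * Csum (fun n => A n * zeta ^ n) d)) =
  p0 * A m + p1 * (if le_dec 1 m then A (m - 1)%nat else 0)
    + p2 * (if le_dec 2 m then A (m - 2)%nat else 0).
Proof.
intros Hm Hd HN.
transitivity (
  p0 * circle_mean N (fun zeta => Cconj zeta ^ m * (zeta ^ 0 * Csum (fun n => A n * zeta ^ n) d)) +
  p1 * circle_mean N (fun zeta => Cconj zeta ^ m * (zeta ^ 1 * Csum (fun n => A n * zeta ^ n) d)) +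
  p2 * circle_mean N (fun zeta => Cconj zeta ^ m * (zeta ^ 2 * Csum (fun n => A n * zeta ^ n) d))).
- rewrite <- !circle_mean_scal, <- !circle_mean_plus.
  apply circle_mean_ext; intros zeta _; unfold quad; simpl; ring.
- rewrite !circle_mean_polynomial, !Csum_delta by lia.
  destruct (le_dec 0 m), (le_dec 1 m), (le_dec 2 m), (le_dec m (d + 0)), (le_dec m (d + 1)), (le_dec m (d + 2)); try lia;
  rewrite ?Nat.sub_0_r; reflexivity.
Qed.

Lemma circle_mean_quad_sq (N : nat) (q0 q1 q2 : C) :
  (2 <= N)%nat ->
  circle_mean N (fun zeta => Cconj (quad q0 q1 q2 zeta) * quad q0 q1 q2 zeta) = sq3 q0 q1 q2.
Proof.
intros HN; rewrite circle_mean_conj_quad_mul.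
assert (H : forall m, (m <= 2)%nat ->
  circle_mean N (fun zeta => Cconj zeta ^ m * quad q0 q1 q2 zeta) =
  q0 * (if Nat.eq_dec m 0 then 1 else 0) + q1 * (if Nat.eq_dec m 1 then 1 else 0)
   + q2 * (if Nat.eq_dec m 2 then 1 else 0)).
{ intros m Hm; rewrite <- !(circle_mean_monomial N m) by lia.
  rewrite <- !circle_mean_scal, <- !circle_mean_plus.
  apply circle_mean_ext; intros zeta _; unfold quad; simpl; ring. }
rewrite !H by lia; simpl.
unfold sq3; rewrite !RtoC_plus, !Cmod2_conj; ring.
Qed.

(** Let [g] be the truncated product of [p] and the polynomial [S] with
    coefficients [A], viewed as a quadratic polynomial. The mean of
    [conj g * p * S] is the squared norm of [g] by orthonormality, while
    [|conj g * p * S| <= (|g|^2 + M^2 |p|^2) / 2] pointwise on the circle.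
    Averaging the latter gives
    [|g|^2 <= (|g|^2 + M^2 |p|^2) / 2] for the norms. *)
Lemma toeplitz_le_of_polynomial (A : nat -> C) (d : nat) (M : R) (p0 p1 p2 : C) :
  (2 <= d)%nat -> (0 <= M)%R ->
  (forall zeta, Cmod zeta = 1%R -> (Cmod (Csum (fun n => (A n * zeta ^ n)%C) d) <= M)%R) ->
  (toeplitz_sq A p0 p1 p2 <= M ^ 2 * sq3 p0 p1 p2)%R.
Proof.
intros Hd HM HS.
set (N := (d + 2)%nat).
set (g0 := p0 * A 0%nat); set (g1 := p0 * A 1%nat + p1 * A 0%nat);
set (g2 := p0 * A 2%nat + p1 * A 1%nat + p2 * A 0%nat).
set (S := fun zeta => Csum (fun n => A n * zeta ^ n) d).
assert (HL : circle_mean N (fun zeta =>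
    Cconj (quad g0 g1 g2 zeta) * (quad p0 p1 p2 zeta * S zeta)) = sq3 g0 g1 g2).
{ rewrite circle_mean_conj_quad_mul.
  unfold S; rewrite !circle_mean_coef_quad_mul by (unfold N; lia).
  simpl; unfold sq3; rewrite !RtoC_plus, !Cmod2_conj; unfold g0, g1, g2; ring. }
assert (HR : circle_mean N (fun zeta =>
    (/ 2)%R * (Cconj (quad g0 g1 g2 zeta) * quad g0 g1 g2 zeta) +
    (M ^ 2 / 2)%R * (Cconj (quad p0 p1 p2 zeta) * quad p0 p1 p2 zeta))
  = (/ 2 * sq3 g0 g1 g2 + M ^ 2 / 2 * sq3 p0 p1 p2)%R).
{ rewrite circle_mean_plus, !circle_mean_scal, !circle_mean_quad_sq by (unfold N; lia).
  rewrite RtoC_plus, !RtoC_mult; reflexivity. }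
assert (Hle := circle_mean_Re_le N
  (fun zeta => Cconj (quad g0 g1 g2 zeta) * (quad p0 p1 p2 zeta * S zeta))
  (fun zeta =>
    (/ 2)%R * (Cconj (quad g0 g1 g2 zeta) * quad g0 g1 g2 zeta) +
    (M ^ 2 / 2)%R * (Cconj (quad p0 p1 p2 zeta) * quad p0 p1 p2 zeta))).
rewrite HL, HR in Hle; cbn [Re fst RtoC] in Hle.
change (toeplitz_sq A p0 p1 p2) with (sq3 g0 g1 g2).
enough (sq3 g0 g1 g2 <= / 2 * sq3 g0 g1 g2 + M ^ 2 / 2 * sq3 p0 p1 p2)%R by lra.
apply Hle; intros zeta Hz.
set (u := quad g0 g1 g2 zeta); set (v := quad p0 p1 p2 zeta).
replace ((/ 2)%R * (Cconj u * u) + (M ^ 2 / 2)%R * (Cconj v * v))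
  with (RtoC (/ 2 * Cmod u ^ 2 + M ^ 2 / 2 * Cmod v ^ 2))
  by (rewrite RtoC_plus, !RtoC_mult, !Cmod2_conj; ring).
cbn [Re fst RtoC].
apply Rle_trans with (Cmod (Cconj u * (v * S zeta))%C).
- eapply Rle_trans; [apply Rle_abs|apply re_le_Cmod].
- rewrite !Cmod_mult, Cmod_conj.
  assert (h := HS zeta Hz); fold (S zeta) in h.
  assert (h1 := Cmod_ge_0 u); assert (h2 := Cmod_ge_0 v).
  apply Rle_trans with (Cmod u * (Cmod v * M))%R.
  + apply Rmult_le_compat_l; [exact h1|]; apply Rmult_le_compat_l; assumption.
  + assert (h3 := pow2_ge_0 (Cmod u - M * Cmod v)); nra.
Qed.

(** * Contractivity of the Toeplitz matrix of a bounded function *)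

Local Open Scope R_scope.

(** On the circle of radius [r < 1] the partial sums converge to [f] uniformly,
    hence a single degree [d] works for all points of the circle. *)
Lemma partial_sums_near_bound (a : nat -> C) (f : C -> C) (r M : R) (eps : posreal) :
  (forall z, Cmod z < 1 -> is_pseries (V := C_NormedModule) a z (f z)) ->
  (forall z, Cmod z < 1 -> Cmod (f z) <= M) ->
  0 <= r < 1 ->
  exists d, (2 <= d)%nat /\
    forall zeta, Cmod zeta = 1 ->
      Cmod (Csum (fun n => (a n * r ^ n * zeta ^ n)%C) d) <= M + eps.
Proof.
intros Ha Hf Hr.
assert (Hc : converges_in_disc a) by (intros z Hz; exists (f z); apply Ha, Hz).
assert (Hs := Series_correct _ (ex_series_Cmod a r Hc Hr)).
set (b := fun n => Cmod (a n) * r ^ n) in *.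
destruct (proj1 (filterlim_locally_ball_norm (U := R_NormedModule) (sum_n b) (Series b)) Hs eps)
  as [N HN].
exists (N + 2)%nat; split; [lia|].
intros zeta Hz.
specialize (HN (N + 2)%nat ltac:(lia)).
change (Rabs (sum_n b (N + 2) - Series b) < eps) in HN; apply Rabs_def2 in HN.
assert (Hcr : Cmod r = r) by (rewrite Cmod_R; apply Rabs_pos_eq; lra).
assert (Hrz : Cmod (r * zeta)%C < 1) by (rewrite Cmod_mult, Hz, Hcr; lra).
assert (H : is_series (V := C_NormedModule) (fun n => (a n * r ^ n * zeta ^ n)%C) (f (r * zeta)%C)).
{ apply is_series_ext with (2 := proj1 (is_pseries_C _ _ _) (Ha _ Hrz)).
  intros n; rewrite Cpow_mult_l; apply Cmult_assoc. }
assert (Ht := is_series_C_tail_le _ b _ _ (N + 2) H Hs).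
set (s := Csum _ (N + 2)) in *.
replace s with (f (r * zeta) + - (f (r * zeta) - s))%C by ring.
eapply Rle_trans; [apply Cmod_triangle|].
rewrite Cmod_opp.
apply Rplus_le_compat; [apply Hf, Hrz|].
apply Rle_trans with (Series b - sum_n b (N + 2)); [|lra].
apply Ht; intros n; unfold b.
rewrite !Cmod_mult, !Cmod_pow, Hz, Hcr, pow1; lra.
Qed.

Lemma sq3_ge_0 (p0 p1 p2 : C) : 0 <= sq3 p0 p1 p2.
Proof.
unfold sq3; repeat apply Rplus_le_le_0_compat; apply pow2_ge_0.
Qed.

(** Apply [toeplitz_le_of_polynomial] with [M = 1 + e] and let [e] tend to 0;
    for [e <= 1] one has [(1 + e)^2 <= 1 + 3 e]. *)
Lemma toeplitz_dilation_le (a : nat -> C) (f : C -> C) (r : R) (p0 p1 p2 : C) :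
  (forall z, Cmod z < 1 -> is_pseries (V := C_NormedModule) a z (f z)) ->
  (forall z, Cmod z < 1 -> Cmod (f z) <= 1) ->
  0 <= r < 1 ->
  toeplitz_sq (fun n => (a n * r ^ n)%C) p0 p1 p2 <= sq3 p0 p1 p2.
Proof.
intros Ha Hf Hr.
assert (HP := sq3_ge_0 p0 p1 p2).
set (P := sq3 p0 p1 p2) in *.
apply le_epsilon; intros eps Heps.
set (e := Rmin 1 (eps / (3 * (P + 1)))).
assert (He : 0 < e) by (apply Rmin_glb_lt; [lra|apply Rdiv_lt_0_compat; lra]).
assert (He1 : e <= 1) by apply Rmin_l.
assert (He2 : e * (3 * (P + 1)) <= eps).
{ apply Rle_trans with (eps / (3 * (P + 1)) * (3 * (P + 1))).
  - apply Rmult_le_compat_r; [lra|apply Rmin_r].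
  - apply Req_le; field; lra. }
destruct (partial_sums_near_bound a f r 1 (mkposreal e He) Ha Hf Hr) as (d & Hd & HS).
simpl in HS.
assert (H := toeplitz_le_of_polynomial (fun n => (a n * r ^ n)%C) d (1 + e) p0 p1 p2 Hd ltac:(lra) HS).
fold P in H; nra.
Qed.

(** Multiplication by a function bounded by 1 is a contraction of the Hardy
    space; this is its compression to polynomials of degree at most 2. The
    passage [r -> 1] uses the vector [(p0, r p1, r^2 p2)], which scales the n-th
    entry of the product by [r ^ n] and yields [r^4 X <= P]. *)
Lemma toeplitz_contraction (a : nat -> C) (f : C -> C) (p0 p1 p2 : C) :
  (forall z, Cmod z < 1 -> is_pseries (V := C_NormedModule) a z (f z)) ->
  (forall z, Cmod z < 1 -> Cmod (f z) <= 1) ->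
  toeplitz_sq a p0 p1 p2 <= sq3 p0 p1 p2.
Proof.
intros Ha Hf.
assert (HX : 0 <= toeplitz_sq a p0 p1 p2) by apply sq3_ge_0.
assert (HP := sq3_ge_0 p0 p1 p2).
set (X := toeplitz_sq a p0 p1 p2) in *; set (P := sq3 p0 p1 p2) in *.
assert (Hr : forall r, 0 <= r < 1 -> r ^ 4 * X <= P).
{ intros r Hr.
  assert (H := toeplitz_dilation_le a f r p0 (r * p1) (r ^ 2 * p2) Ha Hf Hr).
  apply Rle_trans with (toeplitz_sq (fun n => (a n * r ^ n)%C) p0 (r * p1) (r ^ 2 * p2)).
  - unfold X, toeplitz_sq, sq3.
    replace (p0 * (a 0%nat * r ^ 0))%C with (p0 * a 0%nat)%C by (simpl; ring).
    replace (p0 * (a 1%nat * r ^ 1) + r * p1 * (a 0%nat * r ^ 0))%C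
      with (r * (p0 * a 1%nat + p1 * a 0%nat))%C by (simpl; ring).
    replace (p0 * (a 2%nat * r ^ 2) + r * p1 * (a 1%nat * r ^ 1) + r ^ 2 * p2 * (a 0%nat * r ^ 0))%C
      with (r ^ 2 * (p0 * a 2%nat + p1 * a 1%nat + p2 * a 0%nat))%C by (simpl; ring).
    rewrite (Cmod_mult r), (Cmod_mult (r ^ 2)), (Cmod_pow r 2), Cmod_R, (Rabs_pos_eq r) by lra.
    set (x := Cmod (p0 * a 0%nat)%C ^ 2).
    rewrite !Rpow_mult_distr.
    set (y := Cmod (p0 * a 1%nat + p1 * a 0%nat)%C ^ 2).
    set (z := Cmod (p0 * a 2%nat + p1 * a 1%nat + p2 * a 0%nat)%C ^ 2).
    assert (0 <= x) by apply pow2_ge_0; assert (0 <= y) by apply pow2_ge_0.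
    replace ((r ^ 2) ^ 2) with (r ^ 4) by ring.
    assert (0 <= r ^ 2 <= 1) by nra.
    assert (r ^ 4 <= r ^ 2) by (replace (r ^ 4) with (r ^ 2 * r ^ 2) by ring; nra).
    nra.
  - eapply Rle_trans; [exact H|]. unfold P, sq3.
    rewrite (Cmod_mult r), (Cmod_mult (r ^ 2)), (Cmod_pow r 2), Cmod_R, (Rabs_pos_eq r) by lra.
    rewrite !Rpow_mult_distr.
    assert (h1 := pow2_ge_0 (Cmod p1)); assert (h2 := pow2_ge_0 (Cmod p2)).
    assert (0 <= r ^ 2 <= 1) by nra.
    assert ((r ^ 2) ^ 2 <= 1) by nra.
    nra. }
apply Rnot_lt_le; intros Hlt.
(* With [r = 1 - delta], Bernoulli gives [(1 - 4 delta) X <= r^4 X <= P],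
   which this [delta] contradicts. *)
set (delta := (X - P) / (8 * X)).
assert (Hdx : delta * (8 * X) = X - P) by (unfold delta; field; lra).
assert (Hd : 0 < delta) by (unfold delta; apply Rdiv_lt_0_compat; lra).
assert (Hd1 : delta <= 1 / 8) by nra.
specialize (Hr (1 - delta) ltac:(lra)).
assert (1 - 4 * delta <= (1 - delta) ^ 4).
{ assert (0 <= (1 - delta) ^ 2) by apply pow2_ge_0.
  replace ((1 - delta) ^ 4) with (((1 - delta) ^ 2) ^ 2) by ring.
  nra. }
nra.
Qed.

(** * Schur parameters *)

(** The Schwarz-Pick bound for the first two coefficients, in terms of the 2 by 2
    Toeplitz matrix. Among vectors with first entry 1, the test vector
    [(1, conj b0 * b1 / (1 - |b0|^2))] minimises the difference of the two sides
    of the contraction inequality. *)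
Lemma schur_coef_degree_1 (b0 b1 : C) :
  (forall h0 h1 : C,
     Cmod (b0 * h0)%C ^ 2 + Cmod (b1 * h0 + b0 * h1)%C ^ 2 <= Cmod h0 ^ 2 + Cmod h1 ^ 2) ->
  Cmod b0 <= 1 /\ Cmod b1 <= 1 - Cmod b0 ^ 2.
Proof.
intros H.
assert (H0 := H 1%C 0%C).
replace (b0 * 1)%C with b0 in H0 by ring.
replace (b1 * 1 + b0 * 0)%C with b1 in H0 by ring.
rewrite Cmod_1, Cmod_0 in H0.
assert (h0 := Cmod_ge_0 b0); assert (h1 := Cmod_ge_0 b1).
assert (Hb0 : Cmod b0 <= 1) by nra.
split; [exact Hb0|].
set (E := 1 - Cmod b0 ^ 2).
assert (HE : 0 <= E) by (unfold E; nra).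
destruct (Req_dec E 0) as [E0|E0].
- unfold E in *; nra.
- assert (H1 := H 1%C (Cconj b0 * b1 * (/ E)%R)%C).
  replace (b0 * 1)%C with b0 in H1 by ring.
  replace (b1 * 1 + b0 * (Cconj b0 * b1 * (/ E)%R))%C with (b1 * (/ E)%R)%C in H1.
  + rewrite !Cmod_mult, Cmod_conj, Cmod_R, Cmod_1, (Rabs_pos_eq (/ E)) in H1
      by (left; apply Rinv_0_lt_compat; lra).
    set (u := Cmod b1 * / E) in *.
    assert (Hu : Cmod b1 = u * E) by (unfold u; field; exact E0).
    replace (Cmod b0 * Cmod b1 * / E) with (Cmod b0 * u) in H1 by (unfold u; ring).
    assert (Hu0 : 0 <= u) by (apply Rmult_le_pos; [exact h1|left; apply Rinv_0_lt_compat; lra]).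
    assert (Hu1 : u <= 1).
    { assert (E * u ^ 2 <= E) by (unfold E in *; nra).
      assert (u ^ 2 <= 1) by (apply Rmult_le_reg_l with E; lra). nra. }
    rewrite Hu; nra.
  + replace (b1 * 1 + b0 * (Cconj b0 * b1 * (/ E)%R))%C
      with (b1 * (1 + b0 * Cconj b0 * (/ E)%R))%C by ring.
    rewrite <- Cmod2_conj, <- RtoC_mult, <- RtoC_plus.
    do 2 f_equal; unfold E in *; field; exact E0.
Qed.

(** The identity behind the fact that a disc automorphism preserves the disc. *)
Lemma mobius_norm_identity (a u v : C) :
  Cmod (v + Cconj a * u)%C ^ 2 - Cmod (a * v + u)%C ^ 2
  = (1 - Cmod a ^ 2) * (Cmod v ^ 2 - Cmod u ^ 2).
Proof.
rewrite !Cmod2_alt.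
destruct a, u, v; unfold Cconj, Cmult, Cplus, Re, Im; cbn [fst snd]; ring.
Qed.

(** One step of the Schur algorithm on the level of coefficients. Analytically,
    [f = (a0 + z g) / (1 + conj a0 z g)] with [g = b0 + b1 z + ...] again bounded
    by 1. To see the bound on [g] from the contraction inequality for [f] alone,
    test it on the first three coefficients of
    [p = (1 + conj a0 z g) (x0 + x1 z)], for which [f p = (a0 + z g) (x0 + x1 z)];
    by [mobius_norm_identity] the inequality becomes [1 - |a0|^2] times the
    contraction inequality for [g]. *)
Lemma schur_parametrisation (a : nat -> C) :
  (forall p0 p1 p2, toeplitz_sq a p0 p1 p2 <= sq3 p0 p1 p2) ->
  Cmod (a 0%nat) <= 1 /\
  exists b0 b1 : C,
    Cmod b0 <= 1 /\ Cmod b1 <= 1 - Cmod b0 ^ 2 /\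
    a 1%nat = ((1 - Cmod (a 0%nat) ^ 2)%R * b0)%C /\
    a 2%nat = ((1 - Cmod (a 0%nat) ^ 2)%R * (b1 - Cconj (a 0%nat) * b0 ^ 2))%C.
Proof.
intros H.
assert (H0 := H 1%C 0%C 0%C).
unfold toeplitz_sq, sq3 in H0.
replace (1 * a 0%nat)%C with (a 0%nat) in H0 by ring.
replace (1 * a 1%nat + 0 * a 0%nat)%C with (a 1%nat) in H0 by ring.
replace (1 * a 2%nat + 0 * a 1%nat + 0 * a 0%nat)%C with (a 2%nat) in H0 by ring.
rewrite Cmod_1, Cmod_0 in H0.
assert (h0 := Cmod_ge_0 (a 0%nat)); assert (h1 := Cmod_ge_0 (a 1%nat)); assert (h2 := Cmod_ge_0 (a 2%nat)).
assert (Ht : Cmod (a 0%nat) <= 1) by nra.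
split; [exact Ht|].
set (t := Cmod (a 0%nat)) in *.
set (D := 1 - t ^ 2).
assert (HD : 0 <= D) by (unfold D; nra).
destruct (Req_dec D 0) as [D0|D0].
(* If [|a0| = 1] then [f] is constant. *)
- exists 0%C, 0%C; rewrite Cmod_0, D0.
  assert (Cmod (a 1%nat) = 0) by (unfold D in *; nra).
  assert (Cmod (a 2%nat) = 0) by (unfold D in *; nra).
  repeat split; try lra.
  + rewrite (Cmod_eq_0 (a 1%nat)) by assumption; ring.
  + rewrite (Cmod_eq_0 (a 2%nat)) by assumption; ring.
- set (a0 := a 0%nat) in *.
  assert (DC : RtoC D <> 0%C) by (intros h%RtoC_inj; exact (D0 h)).
  set (b0 := (a 1%nat / D)%C).
  set (b1 := (a 2%nat / D + Cconj a0 * b0 ^ 2)%C).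
  assert (Ha1 : a 1%nat = (D * b0)%C) by (unfold b0; field; exact DC).
  assert (Ha2 : a 2%nat = (D * (b1 - Cconj a0 * b0 ^ 2))%C) by (unfold b1; field; exact DC).
  exists b0, b1.
  apply and_assoc; split; [|split; assumption].
  apply schur_coef_degree_1; intros x0 x1.
  set (u1 := (b0 * x0)%C); set (u2 := (b1 * x0 + b0 * x1)%C).
  assert (Hp := H x0 (x1 + Cconj a0 * u1)%C (Cconj a0 * u2)%C).
  unfold toeplitz_sq, sq3 in Hp; fold a0 in Hp.
  assert (HDC : RtoC D = (1 - a0 * Cconj a0)%C)
    by (unfold D, t; rewrite <- Cmod2_conj, RtoC_minus; reflexivity).
  rewrite Ha1, Ha2, HDC in Hp.
  replace (x0 * ((1 - a0 * Cconj a0) * b0) + (x1 + Cconj a0 * u1) * a0)%C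
    with (a0 * x1 + u1)%C in Hp by (unfold u1; ring).
  match type of Hp with context [ (x0 * ?A + ?B + ?C')%C ] =>
    replace (x0 * A + B + C')%C with u2 in Hp by (unfold u1, u2; ring) end.
  assert (Hm := mobius_norm_identity a0 u1 x1).
  fold t in Hm; fold D in Hm.
  rewrite !Cmod_mult, Cmod_conj in Hp; fold t in Hp.
  assert (HH : D * (Cmod u1 ^ 2 + Cmod u2 ^ 2) <= D * (Cmod x0 ^ 2 + Cmod x1 ^ 2))
    by (unfold D in *; nra).
  apply Rmult_le_reg_l in HH; lra.
Qed.

(** * The upper bound *)

(** The bracket is a quadratic in [x] with vertex [3 t / (4 (1 - t))]. The vertex
    is at most 1 exactly when [t <= 4/7], and then the two sides differ by a
    square; for larger [t] the maximum over [0 <= x <= 1] is attained at [x = 1]. *)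
Lemma real_optimum (t x : R) :
  0 <= t <= 1 -> 0 <= x <= 1 ->
  (1 - t ^ 2) * ((1 - x ^ 2) / 3 + t * x ^ 2 / 3 + t * x / 2) <= coef_bound t.
Proof.
intros Ht Hx.
destruct (Rle_dec t (4 / 7)) as [h|h].
- unfold coef_bound; destruct (Rle_dec t (4 / 7)); [|contradiction].
  assert (Hsq := pow2_ge_0 (3 * t - 4 * (1 - t) * x)).
  replace (1 / 48 * (1 + t) * (9 * t ^ 2 - 16 * t + 16)) with
    ((1 - t ^ 2) * ((1 - x ^ 2) / 3 + t * x ^ 2 / 3 + t * x / 2)
     + (1 + t) / 48 * (3 * t - 4 * (1 - t) * x) ^ 2) by field.
  nra.
- rewrite coef_bound_right by lra.
  replace (5 / 6 * t * (1 - t ^ 2)) with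
    ((1 - t ^ 2) * ((1 - x ^ 2) / 3 + t * x ^ 2 / 3 + t * x / 2)
     + (1 - t ^ 2) * ((1 - x) * (t / 2 - (1 - t) * (1 + x) / 3))) by field.
  assert (0 <= t / 2 - (1 - t) * (1 + x) / 3) by nra.
  assert (0 <= (1 - x) * (t / 2 - (1 - t) * (1 + x) / 3)) by (apply Rmult_le_pos; lra).
  assert (0 <= 1 - t ^ 2) by nra.
  nra.
Qed.

(** In the Schur parameters of [w'],
    [c3 - c1 c2 = (1 - |c1|^2) ((b1 - conj c1 b0^2) / 3 - c1 b0 / 2)]. The
    triangle inequality leaves the real maximisation of [real_optimum] with
    [t = |c1|] and [x = |b0|]. *)
Lemma coef_functional_le (w : C -> C) (c : nat -> C) :
  class_B0' w -> power_expansion w c ->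
  Cmod (c 3%nat - c 1%nat * c 2%nat)%C <= coef_bound (Cmod (c 1%nat)).
Proof.
intros (_ & _ & Hw') [_ Hw].
assert (Hf : forall z, Cmod z < 1 -> is_pseries (V := C_NormedModule) (Cderiv_coef c) z (C_derive w z)).
{ intros z Hz.
  destruct (pseries_termwise_derive c w z Hw Hz) as (d & Hd & Hwd).
  rewrite (is_C_derive_unique w z d Hwd); exact Hd. }
destruct (schur_parametrisation (Cderiv_coef c)) as (Ht & b0 & b1 & Hb0 & Hb1 & E1 & E2).
{ intros p0 p1 p2; exact (toeplitz_contraction _ _ p0 p1 p2 Hf Hw'). }
assert (E0 : Cderiv_coef c 0 = c 1%nat)
  by (unfold Cderiv_coef; change (INR 1) with 1; ring).
rewrite E0 in Ht, E1, E2.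
set (t := Cmod (c 1%nat)) in *; set (D := 1 - t ^ 2) in *.
assert (Ht0 : 0 <= t) by apply Cmod_ge_0.
assert (HD : 0 <= D) by (unfold D; nra).
assert (c2 : c 2%nat = (D * b0 * (/ 2)%R)%C).
{ rewrite <- E1; unfold Cderiv_coef.
  change (INR 2) with 2; rewrite RtoC_inv by lra; field; intros h%RtoC_inj; lra. }
assert (c3 : c 3%nat = (D * (b1 - Cconj (c 1%nat) * b0 ^ 2) * (/ 3)%R)%C).
{ rewrite <- E2; unfold Cderiv_coef.
  replace (INR 3) with 3 by (simpl; ring); rewrite RtoC_inv by lra; field; intros h%RtoC_inj; lra. }
apply Rle_trans with (2 := real_optimum t (Cmod b0) (conj Ht0 Ht) (conj (Cmod_ge_0 b0) Hb0)).
fold D.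
replace (c 3%nat - c 1%nat * c 2%nat)%C
  with (D * (b1 * (/ 3)%R + - (Cconj (c 1%nat) * b0 ^ 2 * (/ 3)%R) + - (c 1%nat * b0 * (/ 2)%R)))%C
  by (rewrite c3, c2; ring).
rewrite Cmod_mult, Cmod_R, (Rabs_pos_eq D) by exact HD.
apply Rmult_le_compat_l; [exact HD|].
eapply Rle_trans; [apply Cmod_triangle|].
eapply Rle_trans; [apply Rplus_le_compat_r, Cmod_triangle|].
rewrite !Cmod_opp, !Cmod_mult, Cmod_pow, Cmod_conj, !Cmod_R; fold t.
rewrite (Rabs_pos_eq (/ 3)), (Rabs_pos_eq (/ 2)) by lra.
lra.
Qed.

(** * Extremal functions *)

Local Open Scope C_scope.

(** The sum [l] exists by comparison with the real geometric series, and
    uniqueness of limits gives [l = q l + 1]. *)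
Lemma is_series_C_geom (q : C) :
  (Cmod q < 1)%R -> is_series (V := C_NormedModule) (fun n => q ^ n) (/ (1 - q)).
Proof.
intros Hq.
assert (Hex : exists l : C, is_series (V := C_NormedModule) (fun n => q ^ n) l).
{ apply (ex_series_le (V := C_CompleteNormedModule)) with (fun n => (Cmod q ^ n)%R).
  - intros n; apply Req_le, (Cmod_pow q n).
  - apply ex_series_geom; rewrite Rabs_pos_eq; [exact Hq|apply Cmod_ge_0]. }
destruct Hex as [l Hl].
assert (Hs : is_series (V := C_NormedModule) (fun n => q ^ n) (q * l + 1)).
{ apply (is_series_decr_1 (V := C_NormedModule)).
  match goal with |- is_series _ ?L => replace L with (q * l) end.
  - exact (is_series_scal (V := C_NormedModule) (q : C_AbsRing) _ _ Hl).
  - change (@eq C (q * l) (q * l + 1 + - RtoC 1)); ring. }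
assert (E : l = q * l + 1) by exact (filterlim_locally_unique (V := C_NormedModule) _ _ _ Hl Hs).
assert (Hq1 : 1 - q <> 0).
{ intros E1. assert (Eq : q = 1) by (replace q with (1 - (1 - q)) by ring; rewrite E1; ring).
  rewrite Eq, Cmod_1 in Hq; lra. }
replace (/ (1 - q)) with l; [exact Hl|].
assert (E2 : (1 - q) * l = 1)
  by (transitivity (l - q * l); [ring|rewrite E at 1; ring]).
replace l with (/ (1 - q) * ((1 - q) * l)) by (field; exact Hq1).
rewrite E2; ring.
Qed.

Definition primitive_coef (a : nat -> C) (n : nat) : C :=
  match n with O => RtoC 0 | S m => a m / INR (S m) end.

(** The formal primitive converges on the disc because the modulus of each of its
    terms is at most that of the preceding term of [a]. Its sum is picked by
    [iota], and termwise differentiation identifies the derivative with [g]. *)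
Lemma primitive_in_class (a : nat -> C) (g : C -> C) :
  (forall z, (Cmod z < 1)%R -> is_pseries (V := C_NormedModule) a z (g z)) ->
  (forall z, (Cmod z < 1)%R -> (Cmod (g z) <= 1)%R) ->
  exists w, class_B0' w /\ power_expansion w (primitive_coef a).
Proof.
intros Ha Hg.
set (c := primitive_coef a).
assert (Hca : forall n, Cderiv_coef c n = a n).
{ intros n; unfold Cderiv_coef, c, primitive_coef; field; apply INR_S_neq_0. }
assert (Hex : forall z, (Cmod z < 1)%R -> exists l : C, is_pseries (V := C_NormedModule) c z l).
{ intros z Hz.
  assert (Hz0 := Cmod_ge_0 z).
  assert (Hs : ex_series (fun n => (Cmod (a n) * Cmod z ^ n)%R))
    by (apply ex_series_Cmod; [intros y Hy; exists (g y); apply Ha, Hy|lra]).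
  assert (Hl : ex_series (fun n => c n * z ^ n : C_NormedModule)).
  { apply (ex_series_incr_1 (V := C_NormedModule)).
    apply (ex_series_le (V := C_CompleteNormedModule)) with (2 := Hs).
    intros n; change (Cmod (c (S n) * z ^ S n)%C <= Cmod (a n) * Cmod z ^ n)%R.
    rewrite Cmod_mult, Cmod_pow, <- Hca; unfold Cderiv_coef.
    rewrite Cmod_mult, Cmod_R, (Rabs_pos_eq (INR _)) by apply pos_INR.
    assert (h1 := Cmod_ge_0 (c (S n))).
    assert (h2 : (0 <= Cmod z ^ n)%R) by (apply pow_le, Hz0).
    assert (h3 := pos_INR n).
    assert (h4 : (Cmod z ^ S n <= Cmod z ^ n)%R) by (simpl; nra).
    rewrite S_INR.
    apply Rle_trans with (Cmod (c (S n)) * Cmod z ^ n)%R; [apply Rmult_le_compat_l; assumption|].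
    apply Rmult_le_compat_r; [exact h2|nra]. }
  destruct Hl as [l Hl]; exists l; apply is_pseries_C, Hl. }
set (w := fun z => iota (T := C_CompleteNormedModule) (fun l => is_pseries (V := C_NormedModule) c z l)).
assert (Hw : forall z, (Cmod z < 1)%R -> is_pseries (V := C_NormedModule) c z (w z)).
{ intros z Hz; destruct (Hex z Hz) as [l Hl].
  apply (iota_correct (V := C_CompleteNormedModule)).
  exists l; split; [exact Hl|].
  intros l' Hl'; exact (filterlim_locally_unique (V := C_NormedModule) _ _ _ Hl Hl'). }
assert (Hd : forall z, (Cmod z < 1)%R -> is_derive (K := C_AbsRing) (V := C_NormedModule) w z (g z)).
{ intros z Hz; destruct (pseries_termwise_derive c w z Hw Hz) as (d & Hs & Hd).
  apply (is_pseries_ext (V := C_NormedModule) _ a _ _ Hca) in Hs.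
  assert (E : d = g z) by exact (filterlim_locally_unique (V := C_NormedModule) _ _ _ Hs (Ha z Hz)).
  rewrite <- E; exact Hd. }
assert (He : power_expansion w c) by (split; [reflexivity|exact Hw]).
exists w; split; [|exact He].
split; [|split].
- intros z Hz; exists (g z); apply Hd, Hz.
- exists c; exact He.
- intros z Hz; rewrite (is_C_derive_unique w z (g z)) by apply Hd, Hz; apply Hg, Hz.
Qed.

Lemma primitive_functional (a : nat -> C) :
  primitive_coef a 3 - primitive_coef a 1 * primitive_coef a 2
  = (/ 3)%R * a 2%nat - (/ 2)%R * (a 0%nat * a 1%nat).
Proof.
unfold primitive_coef.
replace (INR 3) with 3%R by (simpl; ring); change (INR 2) with 2%R; change (INR 1) with 1%R.
rewrite !RtoC_inv by lra; field.
Qed.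

Lemma is_pseries_sq (z : C) :
  is_pseries (V := C_NormedModule) (fun n => if Nat.eq_dec n 2 then RtoC 1 else RtoC 0) z (z ^ 2).
Proof.
apply is_pseries_C, is_series_C_eps.
intros eps; exists 2%nat; intros n Hn.
assert (E : Csum (fun n => (if Nat.eq_dec n 2 then RtoC 1 else RtoC 0) * z ^ n) n = z ^ 2).
{ induction Hn as [|n Hn IH].
  - rewrite !sum_Sn, sum_O; change (@plus C_AbelianMonoid) with Cplus; simpl.
    match goal with |- ?A = ?B => change (@eq C A B) end; ring.
  - rewrite sum_Sn, IH; change (@plus C_AbelianMonoid) with Cplus.
    destruct (Nat.eq_dec (S n) 2); [lia|].
    match goal with |- ?A = ?B => change (@eq C A B) end; ring. }
match goal with |- (Cmod (?s - _) < _)%R => replace s with (z ^ 2) by (symmetry; exact E) end.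
replace (z ^ 2 - z ^ 2) with (RtoC 0) by ring.
rewrite Cmod_0; apply cond_pos.
Qed.

(** Taylor coefficients of [(t + z) / (1 + t z)]. *)
Definition mobius_coef (t : R) (n : nat) : C :=
  match n with O => RtoC t | S m => (1 - t ^ 2)%R * RtoC (- t)%R ^ m end.

Lemma mobius_den_neq_0 (t : R) (z : C) :
  (0 <= t <= 1)%R -> (Cmod z < 1)%R -> 1 + t * z <> 0.
Proof.
intros Ht Hz E.
assert (E1 : t * z = - (1)) by (replace (t * z) with (1 + t * z - 1) by ring; rewrite E; ring).
apply (f_equal Cmod) in E1.
rewrite Cmod_m1, Cmod_mult, Cmod_R, Rabs_pos_eq in E1 by lra.
assert (h := Cmod_ge_0 z); nra.
Qed.

Lemma is_pseries_mobius (t : R) (z : C) :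
  (0 <= t <= 1)%R -> (Cmod z < 1)%R ->
  is_pseries (V := C_NormedModule) (mobius_coef t) z ((t + z) / (1 + t * z)).
Proof.
intros Ht Hz; apply is_pseries_C, (is_series_decr_1 (V := C_NormedModule)).
set (q := (- t)%R * z).
assert (Hq : (Cmod q < 1)%R).
{ unfold q; rewrite Cmod_mult, Cmod_R, Rabs_Ropp, Rabs_pos_eq by lra.
  assert (h := Cmod_ge_0 z); nra. }
match goal with |- is_series _ ?L => replace L with ((1 - t ^ 2)%R * z * / (1 - q)) end.
- eapply is_series_ext;
    [|exact (is_series_scal (V := C_NormedModule) ((1 - t ^ 2)%R * z : C_AbsRing) _ _ (is_series_C_geom q Hq))].
  intros n; unfold mobius_coef, q; rewrite Cpow_mult_l.
  change (@eq C ((1 - t ^ 2)%R * z * (RtoC (- t)%R ^ n * z ^ n)) ((1 - t ^ 2)%R * RtoC (- t)%R ^ n * (z * z ^ n))).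
  ring.
- change (@eq C ((1 - t ^ 2)%R * z * / (1 - q)) ((t + z) / (1 + t * z) + - (RtoC t * 1))).
  assert (h := mobius_den_neq_0 t z Ht Hz).
  unfold q; rewrite RtoC_opp, RtoC_minus, RtoC_pow.
  replace (1 - - t * z) with (1 + t * z) by ring.
  field; exact h.
Qed.

Lemma Cmod_mobius_le (t : R) (z : C) :
  (0 <= t <= 1)%R -> (Cmod z < 1)%R -> (Cmod ((t + z) / (1 + t * z))%C <= 1)%R.
Proof.
intros Ht Hz.
assert (Hd := mobius_den_neq_0 t z Ht Hz).
rewrite Cmod_div by exact Hd.
assert (Hp : (0 < Cmod (1 + t * z)%C)%R) by (apply Cmod_gt_0, Hd).
apply Rmult_le_reg_r with (Cmod (1 + t * z)%C); [exact Hp|].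
unfold Rdiv; rewrite Rmult_assoc, Rinv_l, Rmult_1_l, Rmult_1_r by lra.
assert (H := mobius_norm_identity t z 1).
replace (1 + Cconj t * z) with (1 + t * z) in H
  by (f_equal; f_equal; apply injective_projections; simpl; ring).
replace (t * 1 + z) with (t + z) in H by ring.
rewrite Cmod_1, Cmod_R, Rabs_pos_eq in H by lra.
assert (h := Cmod_ge_0 z); assert (h' := Cmod_ge_0 (t + z)%C).
assert (0 <= (1 - t ^ 2) * (1 ^ 2 - Cmod z ^ 2))%R by (apply Rmult_le_pos; nra).
nra.
Qed.

(** The maximiser in [real_optimum] is [x = 0] when [t = 0], so [b0 = 0] and
    [|b1| = 1], as for [w' = z^2]. It is [x = 1] when [4/7 <= t < 1], so
    [|b0| = 1], as for a disc automorphism; with [b0 = 1] and [c1 = t] the terms of the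
    triangle inequality are aligned. *)
Lemma coef_bound_attained (t : R) :
  (t = 0 \/ 4 / 7 <= t <= 1)%R ->
  exists (w : C -> C) (c : nat -> C),
    class_B0' w /\ power_expansion w c /\ Cmod (c 1%nat) = t /\
    Cmod (c 3%nat - c 1%nat * c 2%nat) = coef_bound (Cmod (c 1%nat)).
Proof.
intros [-> | Ht].
- destruct (primitive_in_class (fun n => if Nat.eq_dec n 2 then RtoC 1 else RtoC 0) (fun z => z ^ 2))
    as (w & Hw & He).
  + intros z _; apply is_pseries_sq.
  + intros z Hz; rewrite Cmod_pow; assert (h := Cmod_ge_0 z); nra.
  + exists w, (primitive_coef (fun n => if Nat.eq_dec n 2 then RtoC 1 else RtoC 0)).
    assert (E1 : Cmod (primitive_coef (fun n => if Nat.eq_dec n 2 then RtoC 1 else RtoC 0) 1) = 0%R).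
    { transitivity (Cmod 0); [f_equal; simpl; unfold Cdiv; ring|apply Cmod_0]. }
    split; [exact Hw|split; [exact He|split; [exact E1|]]].
    rewrite E1, primitive_functional; simpl.
    replace ((/ 3)%R * 1 - (/ 2)%R * (0 * 0)) with (RtoC (/ 3)) by ring.
    rewrite Cmod_R, Rabs_pos_eq by lra.
    unfold coef_bound; destruct (Rle_dec 0 (4 / 7)); [field|lra].
- assert (Ht' : (0 <= t <= 1)%R) by lra.
  destruct (primitive_in_class (mobius_coef t) (fun z => (t + z) / (1 + t * z))) as (w & Hw & He).
  + intros z Hz; apply is_pseries_mobius; assumption.
  + intros z Hz; apply Cmod_mobius_le; assumption.
  + exists w, (primitive_coef (mobius_coef t)).
    assert (E1 : Cmod (primitive_coef (mobius_coef t) 1) = t).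
    { transitivity (Cmod t); [f_equal|rewrite Cmod_R, Rabs_pos_eq; lra].
      unfold primitive_coef, mobius_coef; change (INR 1) with 1%R; field. }
    split; [exact Hw|split; [exact He|split; [exact E1|]]].
    rewrite E1, primitive_functional, coef_bound_right by lra.
    unfold mobius_coef.
    transitivity (Cmod (- (RtoC (5 / 6 * t * (1 - t ^ 2)))%R)).
    * f_equal.
      rewrite <- !RtoC_pow, <- !RtoC_mult, <- RtoC_minus, <- RtoC_opp; f_equal; field.
    * rewrite Cmod_opp, Cmod_R, Rabs_pos_eq; [reflexivity|].
      apply Rmult_le_pos; nra.
Qed.

Theorem theorem1 :
  (forall (w : C -> C) (c : nat -> C),
     class_B0' w -> power_expansion w c ->
     (Cmod (c 3%nat - c 1%nat * c 2%nat)%C <= coef_bound (Cmod (c 1%nat)))%R)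
  /\
  (forall t : R, (t = 0 \/ 4 / 7 <= t <= 1)%R ->
     exists (w : C -> C) (c : nat -> C),
       class_B0' w /\ power_expansion w c /\ Cmod (c 1%nat) = t /\
       Cmod (c 3%nat - c 1%nat * c 2%nat) = coef_bound (Cmod (c 1%nat))).
Proof.
split; [exact coef_functional_le | exact coef_bound_attained].
Qed.
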